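(* Let $\mathcal{J}=\{1,\dots,d\}\subseteq\{1,\dots,D\}$, let $S=(S_1,\dots,S_d)$ be a $d$-dimensional subdivision, let $t\in[0,1]\setminus S_1$ and let $S'=S\cup_1t=(S'_1,\dots,S'_d)$, i.e. $S'_1=S_1\cup\{t\}$ and $S'_j=S_j$ for $j\ge2$. Write $m_1=m_{S_1}$ and let $\nu\in\{1,\dots,m_1-1\}$ be such that $t^{(S_1)}_{(\nu)}<t<t^{(S_1)}_{(\nu+1)}$. Define, for $\underline\ell=(\ell_1,\dots,\ell_d)\in\mathcal{L}_{S'}$, $$\beta_{\underline\ell}=(\widehat\alpha_{\mathcal{J},S})_{\underline\ell}-(\widehat\alpha_{\mathcal{J},S'})_{\underline\ell}\quad\text{if }\ell_1\in\{1,\dots,\nu\},$$ $$\beta_{\underline\ell}=(\widehat\alpha_{\mathcal{J},S})_{(\nu,\ell_2,\dots,\ell_d)}\frac{t^{(S_1)}_{(\nu+1)}-t}{t^{(S_1)}_{(\nu+1)}-t^{(S_1)}_{(\nu)}}+(\widehat\alpha_{\mathcal{J},S})_{(\nu+1,\ell_2,\dots,\ell_d)}\frac{t-t^{(S_1)}_{(\nu)}}{t^{(S_1)}_{(\nu+1)}-t^{(S_1)}_{(\nu)}}-(\widehat\alpha_{\mathcal{J},S'})_{\underline\ell}\quad\text{if }\ell_1=\nu+1,$$ $$\beta_{\underline\ell}=(\widehat\alpha_{\mathcal{J},S})_{(\ell_1-1,\ell_2,\dots,\ell_d)}-(\widehat\alpha_{\mathcal{J},S'})_{\underline\ell}\quad\text{if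 }\ell_1\in\{\nu+2,\dots,m_1+1\}.$$ For $\underline\ell,\underline\ell'\in\mathcal{L}_{S'}$ define $\Psi_{\underline\ell,\underline\ell'}=\prod_{j=1}^d\psi^{(j)}_{\ell_j,\ell'_j}$ if $|\ell_j-\ell'_j|\le1$ for all $j=1,\dots,d$, and $\Psi_{\underline\ell,\underline\ell'}=0$ otherwise, where, for $|\ell_j-\ell'_j|\le1$, $$\psi^{(j)}_{\ell_j,\ell'_j}=\begin{cases}\frac{1}{3}\big(t^{(S'_j)}_{(\ell_j+1)}-t^{(S'_j)}_{(\ell_j)}\big)&\text{if }\ell_j=\ell'_j=1,\\ \frac13\big(t^{(S'_j)}_{(\ell_j)}-t^{(S'_j)}_{(\ell_j-1)}\big)&\text{if }\ell_j=\ell'_j=m_{S'_j},\\ \frac13\big(t^{(S'_j)}_{(\ell_j+1)}-t^{(S'_j)}_{(\ell_j-1)}\big)&\text{if }\ell_j=\ell'_j\in\{2,\dots,m_{S'_j}-1\},\\ \frac16\big(t^{(S'_j)}_{(\ell_j+1)}-t^{(S'_j)}_{(\ell_j)}\big)&\text{if }\ell'_j=\ell_j+1,\\ \frac16\big(t^{(S'_j)}_{(\ell_j)}-t^{(S'_j)}_{(\ell_j-1)}\big)&\text{if }\ell'_j=\ell_j-1.\end{cases}$$ Then $$\int_{[0,1]^d}\big(\widehat{Y}_{\mathcal{J},S}(x)-\widehat{Y}_{\mathcal{J},S\cup_1t}(x)\big)^2dx=\sum_{\underline\ell\in\mathcal{L}_{S'},\ \underline\ell'\in\mathcal{L}_{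S'}}\beta_{\underline\ell}\,\Psi_{\underline\ell,\underline\ell'}\,\beta_{\underline\ell'}.$$
   Context: Subdivisions: a one-dimensional subdivision is a finite set $S\subset\mathbb{R}$ with ordered elements $-1=t^{(S)}_{(0)}<0=t^{(S)}_{(1)}<\dots<t^{(S)}_{(m_S)}=1<t^{(S)}_{(m_S+1)}=2$. A $d$-dimensional subdivision is a vector $S=(S_1,\dots,S_d)$ of these; $\mathcal{L}_S=\prod_{i=1}^d\{1,\dots,m_{S_i}\}$, $A_S=\mathbb{R}^{\mathcal{L}_S}$, $t^{(S)}_{\underline\ell}=(t^{(S_1)}_{(\ell_1)},\dots,t^{(S_d)}_{(\ell_d)})$. Basis functions: for $u<v<w$, $\phi_{u,v,w}(t)=\frac{t-u}{v-u}$ for $u\le t\le v$, $\frac{w-t}{w-v}$ for $v\le t\le w$, $0$ otherwise; $\phi^{(S)}_{\underline\ell}(t)=\prod_{i=1}^d\phi_{t^{(S_i)}_{(\ell_i-1)},t^{(S_i)}_{(\ell_i)},t^{(S_i)}_{(\ell_i+1)}}(t_i)$ on $[0,1]^d$; $Y_{S,\alpha}=\sum_{\underline\ell\in\mathcal{L}_S}\alpha_{\underline\ell}\phi^{(S)}_{\underline\ell}$ for $\alpha\in A_S$. Mode: let $x_D^{(1)},\dots,x_D^{(n)}\in[0,1]^D$, $y_1,\dots,y_n\in\mathbb{R}$, let $x^{(i)}_{\mathcal{J}}$ be the vector of the first $d$ coordinates of $x_D^{(i)}$ (assumed pairwise distinct), let $\mathcal{C}_D$ be a convex subset of $\mathcal{C}([0,1]^D,\mathbb{R})$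 closed for uniform convergence, $\mathcal{C}_{\mathcal{J}}$ the set of $g:[0,1]^d\to\mathbb{R}$ such that $x\in[0,1]^D\mapsto g(x_1,\dots,x_d)$ is in $\mathcal{C}_D$, $k_D$ a continuous covariance function on $[0,1]^D\times[0,1]^D$, $k_{\mathcal{J}}(u,v)=k_D((u,0),(v,0))$ (padding by zeros), and $k_{\mathcal{J}}(S,S)=[k_{\mathcal{J}}(t^{(S)}_{\underline\ell},t^{(S)}_{\underline\ell'})]_{\underline\ell,\underline\ell'\in\mathcal{L}_S}$, assumed invertible for every $S$. Then $\widehat\alpha_{\mathcal{J},S}=\mathrm{argmin}\{\alpha^\top k_{\mathcal{J}}(S,S)^{-1}\alpha:\ \alpha\in A_S,\ Y_{S,\alpha}\in\mathcal{C}_{\mathcal{J}},\ Y_{S,\alpha}(x^{(i)}_{\mathcal{J}})=y_i\text{ for }i=1,\dots,n\}$, the feasible set for $S$ being assumed non-empty, and $\widehat{Y}_{\mathcal{J},S}=Y_{S,\widehat\alpha_{\mathcal{J},S}}$ (and likewise with $S'$ in place of $S$). *)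

(* Defs.v *)
From HB Require Import structures.
From mathcomp Require Import all_boot all_order all_algebra finmap.
From mathcomp Require Import all_classical all_reals all_analysis.

Set Implicit Arguments.
Unset Strict Implicit.
Unset Printing Implicit Defensive.

Import Order.TTheory GRing.Theory Num.Theory.
Import numFieldNormedType.Exports.

Local Open Scope classical_set_scope.
Local Open Scope ring_scope.

(* Lebesgue measure on R^n, points being n-tuples; built by iterating the      *)
(* binary product measure along (a, x) |-> a :: x.                            *)
Section lebesgue_cons.
Context (R : realType) (n : nat).
Variable m : {sigma_finite_measure set (n.-tuple (measurableTypeR R)) -> \bar R}.

Let consp (p : measurableTypeR R * n.-tuple (measurableTypeR R)) :
  n.+1.-tuple (measurableTypeR R) := [tuple of p.1 :: p.2].

Let unconsp (x : n.+1.-tuple (measurableTypeR R)) :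
  measurableTypeR R * n.-tuple (measurableTypeR R) :=
  (thead x, [tuple of behead x]).

Let mconsp : measurable_fun setT consp.
Proof. exact: (measurable_cons measurable_fst measurable_snd). Qed.

Let munconsp : measurable_fun setT unconsp.
Proof.
apply: measurable_fun_pair; first exact: measurable_tnth.
exact: measurable_behead.
Qed.

Let conspK : cancel consp unconsp.
Proof.
by case=> a x; rewrite /unconsp /consp theadE; congr pair; exact/val_inj.
Qed.

Definition lebesgue_cons : set (n.+1.-tuple (measurableTypeR R)) -> \bar R :=
  pushforward (@lebesgue_measure R \x m)%E
    (fun p : measurableTypeR R * n.-tuple (measurableTypeR R) =>
       [tuple of p.1 :: p.2]).

Let lebesgue_cons0 : lebesgue_cons set0 = 0%E.
Proof. by rewrite /lebesgue_cons /pushforward preimage_set0 measure0. Qed.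

Let lebesgue_cons_ge0 A : (0 <= lebesgue_cons A)%E.
Proof. exact: measure_ge0. Qed.

Let lebesgue_cons_sigma_additive : semi_sigma_additive lebesgue_cons.
Proof.
move=> F mF tF mUF; rewrite /lebesgue_cons /pushforward preimage_bigcup.
apply: measure_semi_sigma_additive.
- by move=> i; rewrite -[X in measurable X]setTI; exact: mconsp.
- apply/trivIsetP => /= i j _ _ ij; rewrite -preimage_setI.
  by move/trivIsetP : tF => /(_ _ _ _ _ ij) ->//; rewrite preimage_set0.
- by rewrite -preimage_bigcup -[X in measurable X]setTI; exact: mconsp.
Qed.

HB.instance Definition _ := isMeasure.Build _ _ _ lebesgue_cons
  lebesgue_cons0 lebesgue_cons_ge0 lebesgue_cons_sigma_additive.

Let lebesgue_cons_sigma_finite : sigma_finite setT lebesgue_cons.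
Proof.
have /sigma_finiteP[F [TF ndF Foo]] := sigma_finiteT (@lebesgue_measure R).
have /sigma_finiteP[G [TG ndG Goo]] := sigma_finiteT m.
exists (fun i => unconsp @^-1` (F i `*` G i)) => [|i].
  rewrite -preimage_bigcup (_ : \bigcup_i _ = setT) ?preimage_setT//.
  apply/seteqP; split=> // -[a x] _.
  have [j _ Fja] : (\bigcup_j F j) a by rewrite -TF.
  have [k _ Gkx] : (\bigcup_k G k) x by rewrite -TG.
  exists (maxn j k) => //; split.
  - by move: a Fja; exact/subsetPset/ndF/leq_maxl.
  - by move: x Gkx; exact/subsetPset/ndG/leq_maxr.
have [mF Foo'] := Foo i; have [mG Goo'] := Goo i.
split.
  rewrite -[X in measurable X]setTI; apply: munconsp => //.
  exact: measurableX.
rewrite /lebesgue_cons /pushforward -comp_preimage.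
rewrite (_ : unconsp \o _ = id); last by apply/funext; exact: conspK.
by rewrite preimage_id product_measure1E// lte_mul_pinfty// ge0_fin_numE.
Qed.

HB.instance Definition _ := Measure_isSigmaFinite.Build _ _ _ lebesgue_cons
  lebesgue_cons_sigma_finite.

End lebesgue_cons.

Fixpoint lebesgue_tuple (R : realType) (n : nat) :
    {sigma_finite_measure set (n.-tuple (measurableTypeR R)) -> \bar R} :=
  match n with
  | 0 => \d_([tuple])
  | n'.+1 => lebesgue_cons (lebesgue_tuple R n')
  end.

Lemma lebesgue_tuple_box (R : realType) n (A : 'I_n -> set (measurableTypeR R)) :
  (forall i, measurable (A i)) ->
  lebesgue_tuple R n [set x | forall i, A i (tnth x i)] =
  (\prod_(i < n) lebesgue_measure (A i))%E.
Proof.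
elim: n A => [A _|n IH A mA] /=.
  by rewrite big_ord0 diracE mem_set//= => -[].
rewrite big_ord_recl -(IH (fun i => A (lift ord0 i)))// -product_measure1E//; last first.
  rewrite (_ : [set _ | _] = \bigcap_(i in setT) ((@tnth _ _ ^~ i) @^-1` (A (lift ord0 i)))).
    apply: fin_bigcap_measurable => // i _.
    by rewrite -[X in measurable X]setTI; exact: measurable_tnth.
  by apply/seteqP; split=> [x H i _|x H i]; [exact: H|exact: (H i I)].
rewrite /lebesgue_cons /pushforward; congr (_ _).
apply/seteqP; split => -[a x] /=.
  move=> H; split; first exact: (H ord0).
  by move=> i; have := H (lift ord0 i); rewrite tnthS.
move=> [Ha Hx] i; case: (unliftP ord0 i) => [j|] ->; first by rewrite tnthS; exact: Hx.
exact: Ha.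
Qed.

Section cube.
Context (R : realType).

Definition cube d : set 'rV[R]_d := [set x | forall i, 0 <= x ord0 i <= 1].

(* Row vectors carry the topology and tuples the sigma-algebra: a function of  *)
(* a row vector is integrated over the cube through the obvious bijection.     *)
Definition cube_integral d (f : 'rV[R]_d -> R) : \bar R :=
  (\int[lebesgue_tuple R d]_(x in [set x | cube (\row_i tnth x i)])
     (f (\row_i tnth x i))%:E)%E.

End cube.

Section subdivision.
Context (R : realType).

Definition knot (s : {fset R}) (l : nat) : R := nth 0 (sort <=%O (enum_fset s)) l.

(* The inner knots are numbered 1, ..., nknots s; there are two outer ones.    *)
Definition nknots (s : {fset R}) : nat := (#|` s| - 2)%N.

Definition subdivision1 (s : {fset R}) : Prop :=
  [/\ knot s 0 = -1, knot s 1 = 0,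
      knot s (nknots s) = 1 & knot s (nknots s).+1 = 2].

Definition subdivision d (S : 'I_d -> {fset R}) : Prop :=
  forall i, subdivision1 (S i).

(* S \cup_1 t *)
Definition add_knot d (S : 'I_d.+1 -> {fset R}) (t : R) : 'I_d.+1 -> {fset R} :=
  fun i => if i == ord0 then (t |` S i)%fset else S i.

(* The multi-indices L_S. An ordinal (l i : 'I_(nknots (S i))) is 0-based and  *)
(* stands for the knot number ell_i = (l i).+1 in {1, ..., nknots (S i)}.      *)
Definition midx d (S : 'I_d -> {fset R}) : finType :=
  {dffun forall i : 'I_d, 'I_(nknots (S i))}.

Definition midx_val d (S : 'I_d -> {fset R}) (l : midx S) : 'I_d -> nat :=
  fun i => (l i).+1.

Definition coefs d (S : 'I_d -> {fset R}) := {ffun midx S -> R}.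

(* The coefficient at a 1-based integer multi-index, 0 outside of L_S.         *)
Definition coef_at d (S : 'I_d -> {fset R}) (a : coefs S) (p : 'I_d -> nat) : R :=
  if [pick l : midx S | [forall i, midx_val l i == p i]] is Some l then a l
  else 0.

Definition grid d (S : 'I_d -> {fset R}) (l : midx S) : 'rV[R]_d :=
  \row_i knot (S i) (midx_val l i).

Definition hat (u v w t : R) : R :=
  if u <= t <= v then (t - u) / (v - u)
  else if v <= t <= w then (w - t) / (w - v)
  else 0.

Definition basis d (S : 'I_d -> {fset R}) (l : midx S) (x : 'rV[R]_d) : R :=
  \prod_(i < d) hat (knot (S i) (midx_val l i).-1) (knot (S i) (midx_val l i))
                    (knot (S i) (midx_val l i).+1) (x ord0 i).

Definition interp d (S : 'I_d -> {fset R}) (a : coefs S) (x : 'rV[R]_d) : R :=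
  \sum_(l : midx S) a l * basis l x.

End subdivision.

Section mode.
Context (R : realType).

(* Meaningful when the minimiser of q on A exists and is unique.               *)
Definition argmin (T : choiceType) (x0 : T) (A : set T) (q : T -> R) : T :=
  xget x0 [set a | A a /\ forall b, A b -> q a <= q b].

Context (d D : nat) (hdD : (d <= D)%N).

Definition first_coords (x : 'rV[R]_D) : 'rV[R]_d :=
  \row_(i < d) x ord0 (widen_ord hdD i).

Definition pad0 (u : 'rV[R]_d) : 'rV[R]_D :=
  \row_(j < D) if insub (val j) is Some i then u ord0 i else 0.

(* A function on a cube is encoded by total functions, of which only the       *)
(* values on the cube matter. A class CD closed in {uniform` cube -> R} is     *)
(* automatically invariant under changes of its members outside the cube,      *)
(* since functions equal on the cube are not separated by that topology.       *)
Definition restrict_class (CD : set ('rV[R]_D -> R)) : set ('rV[R]_d -> R) :=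
  [set g | CD (fun x => g (first_coords x))].

Definition restrict_kernel (kD : 'rV[R]_D -> 'rV[R]_D -> R) :
    'rV[R]_d -> 'rV[R]_d -> R :=
  fun u v => kD (pad0 u) (pad0 v).

(* Symmetric and positive semi-definite on A.                                  *)
Definition covariance_on T (A : set T) (k : T -> T -> R) : Prop :=
  (forall u v, A u -> A v -> k u v = k v u) /\
  (forall (m : nat) (z : 'I_m -> T) (c : 'I_m -> R), (forall i, A (z i)) ->
     0 <= \sum_(i < m) \sum_(j < m) c i * c j * k (z i) (z j)).

Definition gram (k : 'rV[R]_d -> 'rV[R]_d -> R) (S : 'I_d -> {fset R}) :
    'M[R]_#|midx S| :=
  \matrix_(i, j) k (grid (enum_val i)) (grid (enum_val j)).

Definition energy (k : 'rV[R]_d -> 'rV[R]_d -> R) (S : 'I_d -> {fset R})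
    (a : coefs S) : R :=
  let v : 'cV[R]_#|midx S| := \col_i a (enum_val i) in
  (v^T *m invmx (gram k S) *m v) ord0 ord0.

Definition feasible (C : set ('rV[R]_d -> R)) n (x : 'I_n -> 'rV[R]_d)
    (y : 'I_n -> R) (S : 'I_d -> {fset R}) : set (coefs S) :=
  [set a | C (interp a) /\ forall i, interp a (x i) = y i].

Definition mode_coefs (CD : set ('rV[R]_D -> R)) (kD : 'rV[R]_D -> 'rV[R]_D -> R)
    n (xD : 'I_n -> 'rV[R]_D) (y : 'I_n -> R) (S : 'I_d -> {fset R}) : coefs S :=
  argmin 0 (feasible (restrict_class CD) (fun i => first_coords (xD i)) y (S:=S))
    (energy (restrict_kernel kD) (S:=S)).

End mode.

Section refinement.
Context (R : realType).

Definition set_first d (k : nat) (p : 'I_d.+1 -> nat) : 'I_d.+1 -> nat :=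
  fun i => if i == ord0 then k else p i.

Definition beta d (S : 'I_d.+1 -> {fset R}) (t : R) (nu : nat)
    (a : coefs S) (a' : coefs (add_knot S t)) (l : midx (add_knot S t)) : R :=
  let p := midx_val l in
  let tl := knot (S ord0) nu in
  let tr := knot (S ord0) nu.+1 in
  (if (p ord0 <= nu)%N then coef_at a p
   else if p ord0 == nu.+1 then
     coef_at a (set_first nu p) * ((tr - t) / (tr - tl)) +
     coef_at a (set_first nu.+1 p) * ((t - tl) / (tr - tl))
   else coef_at a (set_first (p ord0).-1 p)) - a' l.

(* Used for indices in {1, ..., nknots s} at distance at most 1.               *)
Definition psi (s : {fset R}) (l l' : nat) : R :=
  if l == l' then
    if l == 1%N then (knot s l.+1 - knot s l) / 3
    else if l == nknots s then (knot s l - knot s l.-1) / 3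
    else (knot s l.+1 - knot s l.-1) / 3
  else if l' == l.+1 then (knot s l.+1 - knot s l) / 6
  else (knot s l - knot s l.-1) / 6.

Definition Psi d (S : 'I_d -> {fset R}) (l l' : midx S) : R :=
  let p := midx_val l in let p' := midx_val l' in
  if [forall j, (p j <= (p' j).+1)%N && (p' j <= (p j).+1)%N]
  then \prod_(j < d) psi (S j) (p j) (p' j) else 0.

End refinement.

(* Main.v *)
Require Import Defs.
From mathcomp Require Import all_boot all_order all_algebra finmap.
From mathcomp Require Import all_classical all_reals all_analysis.
From mathcomp Require Import measurable_realfun ring lra zify.

(** Adding a knot does not change an interpolant, so the difference of the two
    modes is a single multilinear spline on the finer grid, and its L2 norm can
    be read off from the mass matrix of the spline basis.

    A hat function of a subdivision is affine between two consecutive knots of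
    any finer subdivision, so there it is determined by its values at the finer
    knots ([hatk_refine]). Taking products over the coordinates,
    every interpolant on S is the interpolant on a refinement S' of its own
    values at the grid of S' ([interp_refine]). When S' is S with t added
    in the first direction, these grid values are the old coefficients, except
    at t, where affinity on the cell of t gives the convex combination that
    defines beta ([interp_beta]). Hence, on the cube, the difference of the
    two interpolants is the interpolant on S' with coefficients beta.

    The square of such an interpolant is a quadratic form in the coefficients,
    whose entries are the integrals of products of two basis functions. These
    products are non-negative and split over the coordinates, so Tonelli's
    theorem reduces them to one-dimensional integrals ([cube_integral_prod]).
    In dimension one the integral is computed cell by cell: on each cell only
    two hat functions survive, both affine, and the moments 1/3 and 1/6 of the
    local coordinates add up to psi ([integral_hatk]). *)

Set Implicit Arguments.
Unset Strict Implicit.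
Unset Printing Implicit Defensive.

Import Order.TTheory GRing.Theory Num.Theory.
Import numFieldNormedType.Exports.
Local Open Scope classical_set_scope.
Local Open Scope ring_scope.

(** * Auxiliary facts on products of sums and on ordered sequences *)

Lemma prod_sum_dffun (R : pzSemiRingType) (I : finType) (T : I -> finType)
    (F : forall i, T i -> R) :
  \prod_i \sum_(j : T i) F i j =
  \sum_(f : {dffun forall i, T i}) \prod_i F i (f i).
Proof.
under eq_bigr => i _ do rewrite (big_tag (T_ := T) (fun i j => F i j)).
rewrite bigA_distr_big_dep.
(* untag only looks at values, so the terms may be made finite functions, as
   required by big_fprod *)
pose P i := [ffun j => F i j].
have E (g : {ffun I -> {i : I & T i}}) i :
    untag 0 (fun j => F i j) (g i) = untag 0 (P i) (g i).
  rewrite /untag; case: eqP => // e.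
  by rewrite ffunE.
under eq_bigr => g _ do under eq_bigr => i _ do rewrite E.
rewrite -(big_fprod 1 _ P).
rewrite (reindex (@fprod_of_dffun _ _)); last exact/onW_bij/fprod_of_dffun_bij.
by apply: eq_bigr => f _; apply: eq_bigr => i _; rewrite /P ffunE fprodE.
Qed.

Lemma locate_cell (R : realType) (f : nat -> R) (a b : nat) (x : R) :
  (a < b)%N -> f a <= x <= f b ->
  exists2 k, (a <= k < b)%N & f k <= x <= f k.+1.
Proof.
elim: b => // b IH; rewrite ltnS leq_eqVlt => /orP[/eqP <- xab|ab /andP[ax xb]].
  by exists a => //; rewrite leqnn ltnSn.
have [xlb|bx] := leP x (f b).
  by have [|k /andP[ak kb] kx] := IH ab; [rewrite ax|exists k => //; rewrite ak ltnW].
by exists b; rewrite ?ltnSn ?(ltnW ab) ?(ltW bx).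
Qed.

(** * Hat functions *)

Section Hat.
Context (R : realType).
Implicit Types u v w x a b : R.

Lemma hat_rising u v w x : u <= x <= v -> hat u v w x = (x - u) / (v - u).
Proof. by rewrite /hat => ->. Qed.

Lemma hat_falling u v w x : u < v -> v < w -> v <= x <= w ->
  hat u v w x = (w - x) / (w - v).
Proof.
move=> uv vw /[dup] vxw /andP[vx xw]; rewrite /hat vxw.
case: ifP => // /andP[_ xv]; have -> : x = v by apply/eqP; rewrite eq_le xv.
by rewrite !divff// subr_eq0 gt_eqF.
Qed.

Lemma hat_left u v w x : u < v -> v < w -> x <= u -> hat u v w x = 0.
Proof.
move=> uv vw xu; rewrite /hat; case: ifP => [/andP[ux _]|_].
  by have -> : x = u; [apply/eqP; rewrite eq_le xu|rewrite subrr mul0r].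
by rewrite (lt_geF (le_lt_trans xu uv)).
Qed.

Lemma hat_right u v w x : u < v -> v < w -> w <= x -> hat u v w x = 0.
Proof.
move=> uv vw wx; rewrite /hat (lt_geF (lt_le_trans vw wx)) andbF.
case: ifP => // /andP[_ xw].
by have -> : x = w; [apply/eqP; rewrite eq_le xw|rewrite subrr mul0r].
Qed.

Lemma hat_ge0 u v w x : u < v -> v < w -> 0 <= hat u v w x.
Proof.
move=> uv vw; rewrite /hat; case: ifP => [/andP[? ?]|_].
  by rewrite divr_ge0// subr_ge0// ltW.
by case: ifP => // /andP[? ?]; rewrite divr_ge0// subr_ge0// ltW.
Qed.

(** The graph of a hat function breaks only at u, v and w, so it is affine on
    any interval that has none of them in its interior. *)
Lemma hat_affine u v w a b x : u < v -> v < w -> a < b ->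
  (u <= a) || (b <= u) -> (v <= a) || (b <= v) -> (w <= a) || (b <= w) ->
  a <= x <= b ->
  hat u v w x = (b - x) / (b - a) * hat u v w a + (x - a) / (b - a) * hat u v w b.
Proof.
move=> uv vw ab.
have ba0 : b - a != 0 by rewrite subr_eq0 gt_eqF.
have vu0 : v - u != 0 by rewrite subr_eq0 gt_eqF.
have wv0 : w - v != 0 by rewrite subr_eq0 gt_eqF.
move=> /orP[ua|bu]; last first.
  by move=> _ _ /andP[ax xb]; rewrite !hat_left//; lra.
move=> /orP[va|bv]; last first.
  move=> _ /andP[ax xb]; rewrite !hat_rising; [by field; rewrite ?ba0 ?vu0 ?wv0|lra..].
move=> /orP[wa|bw] /andP[ax xb].
  by rewrite !hat_right//; lra.
by rewrite !hat_falling//; [field; rewrite ?ba0 ?vu0 ?wv0|lra..].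
Qed.

End Hat.

(** * Hat functions attached to the knots of a subdivision *)

Section Knots.
Context (R : realType).
Implicit Types s : {fset R}.

Lemma size_sort_fset s : size (sort <=%O (enum_fset s)) = #|` s|.
Proof. by rewrite size_sort. Qed.

Lemma sorted_knots s : sorted <%O (sort <=%O (enum_fset s)).
Proof. by rewrite sort_lt_sorted fset_uniq. Qed.

Lemma knot_lt s i j : (i < j)%N -> (j < #|` s|)%N -> knot s i < knot s j.
Proof.
move=> ij js; rewrite /knot lt_sorted_ltn_nth ?inE ?size_sort_fset//.
- exact: sorted_knots.
- exact: ltn_trans ij js.
Qed.

Lemma knot_le s i j : (i <= j)%N -> (j < #|` s|)%N -> knot s i <= knot s j.
Proof.
by rewrite leq_eqVlt => /orP[/eqP->//|ij js]; apply/ltW/knot_lt.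
Qed.

Lemma mem_knot s i : (i < #|` s|)%N -> knot s i \in s.
Proof. by rewrite -size_sort_fset => /(mem_nth 0); rewrite mem_sort. Qed.

Lemma knot_exists s x : x \in s -> exists2 i, (i < #|` s|)%N & knot s i = x.
Proof.
move=> xs; have xs' : x \in sort <=%O (enum_fset s) by rewrite mem_sort.
exists (index x (sort <=%O (enum_fset s))); last by rewrite /knot nth_index.
by rewrite -size_sort_fset index_mem.
Qed.

(** The default value 0 of [knot] is harmless: the prescribed values -1, 0, 1, 2
    force at least two inner knots, hence all the knots in use to be genuine. *)
Lemma subdivision1_card s : subdivision1 s ->
  (1 < nknots s)%N /\ #|` s| = (nknots s).+2.
Proof.
move=> [k0 k1 km _].
have n0 : nknots s != 0%N by apply/negP => /eqP e; move: km; rewrite e k0; lra.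
have n1 : nknots s != 1%N by apply/negP => /eqP e; move: km; rewrite e k1; lra.
by move: n0 n1; rewrite /nknots; lia.
Qed.

(** This is what makes the hat functions of s affine on the cells of s'. *)
Lemma knot_dichotomy s s' k j : {subset s <= s'} -> (k.+1 < #|` s'|)%N ->
  (j < #|` s|)%N -> (knot s j <= knot s' k) || (knot s' k.+1 <= knot s j).
Proof.
move=> ss' ks' js; have [i is' <-] := knot_exists (ss' _ (mem_knot js)).
have [ik|ki] := leqP i k; apply/orP; [left|right]; apply: knot_le => //.
exact: ltnW.
Qed.

Definition hatk s l : R -> R := hat (knot s l.-1) (knot s l) (knot s l.+1).

Lemma hatk_ge0 s l x : subdivision1 s -> (0 < l <= nknots s)%N ->
  0 <= hatk s l x.
Proof.
move=> /subdivision1_card[m1 ms] /andP[l0 lm].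
by apply: hat_ge0; apply: knot_lt; lia.
Qed.

Lemma hatk_kron s l j : subdivision1 s -> (0 < l <= nknots s)%N ->
  (0 < j <= nknots s)%N -> hatk s l (knot s j) = (l == j)%:R.
Proof.
move=> /subdivision1_card[m1 ms] /andP[l0 lm] /andP[j0 jm].
have uv : knot s l.-1 < knot s l by apply: knot_lt; lia.
have vw : knot s l < knot s l.+1 by apply: knot_lt; lia.
rewrite /hatk; case: (ltngtP l j) => lj.
- by rewrite hat_right//; apply: knot_le; lia.
- by rewrite hat_left//; apply: knot_le; lia.
- by rewrite -lj hat_rising ?divff ?subr_eq0 ?gt_eqF// lexx ltW.
Qed.

Lemma hatk_affine s s' k l x : subdivision1 s -> {subset s <= s'} ->
  (k.+1 < #|` s'|)%N -> (0 < l <= nknots s)%N ->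
  knot s' k <= x <= knot s' k.+1 ->
  hatk s l x =
  (knot s' k.+1 - x) / (knot s' k.+1 - knot s' k) * hatk s l (knot s' k) +
  (x - knot s' k) / (knot s' k.+1 - knot s' k) * hatk s l (knot s' k.+1).
Proof.
move=> /subdivision1_card[m1 ms] ss' ks' /andP[l0 lm] kx.
apply: hat_affine => //; do ?[by apply: knot_lt; lia];
  by apply: knot_dichotomy => //; lia.
Qed.

(** Both sides are affine on the cell of s' that contains x, and they agree at
    its two endpoints because the hat functions of s' are dual to its knots. *)
Lemma hatk_refine s s' l x : subdivision1 s -> subdivision1 s' ->
  {subset s <= s'} -> (0 < l <= nknots s)%N -> 0 <= x <= 1 ->
  hatk s l x =
  \sum_(j < nknots s') hatk s l (knot s' j.+1) * hatk s' j.+1 x.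
Proof.
move=> ds ds' ss' lm x01; have [m1 ms'] := subdivision1_card ds'.
have [k /andP[k1 km] kx] : exists2 k, (1 <= k < nknots s')%N &
    knot s' k <= x <= knot s' k.+1.
  by apply: locate_cell => //; case: ds' => _ -> -> _.
rewrite (hatk_affine ds ss' _ lm kx); last lia.
set p := _ / _; set q := (_ - _) / _.
(* knot number k is indexed by the ordinal k.-1 *)
have k' : (k.-1 < nknots s')%N by lia.
have E (j : 'I_(nknots s')) : hatk s' j.+1 x =
    p * (j == Ordinal k')%:R + q * (j == Ordinal km)%:R.
  have jm : (0 < j.+1 <= nknots s')%N by rewrite ltn_ord.
  rewrite (hatk_affine ds' _ _ jm kx)//; last lia.
  rewrite !hatk_kron//; last lia.
  by have -> : (j.+1 == k) = (j == Ordinal k') by rewrite -val_eqE/=; lia.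
under eq_bigr => j _ do rewrite E mulrDr !(mulrCA (hatk _ _ _)) !mulr_natr !mulrb.
rewrite big_split/= -!mulr_sumr -!big_mkcond/= !big_pred1_eq/=.
by rewrite prednK.
Qed.

End Knots.

(** * Inserting a knot *)

Section Insert.
Context (R : realType).
Implicit Types (s : {fset R}) (t : R).

Lemma knot_insert s t nu j : t \notin s -> (nu.+1 < #|` s|)%N ->
  knot s nu < t < knot s nu.+1 ->
  knot (t |` s)%fset j =
  if (j <= nu)%N then knot s j else if j == nu.+1 then t else knot s j.-1.
Proof.
move=> ts nus /andP[nut tnu].
set r := sort <=%O (enum_fset s).
have sr : size r = #|` s| := size_sort_fset s.
have lt1 x : x \in take nu.+1 r -> x < t.
  move=> /(nthP 0)[i]; rewrite size_takel ?sr; last lia.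
  move=> inu <-; rewrite nth_take//; apply: le_lt_trans nut.
  by apply: knot_le; lia.
have lt2 x : x \in drop nu.+1 r -> t < x.
  move=> /(nthP 0)[i]; rewrite size_drop ?sr => inu <-.
  rewrite nth_drop; apply: lt_le_trans tnu _.
  by apply: knot_le; lia.
(* a strictly sorted sequence is determined by its elements *)
have E : sort <=%O (enum_fset (t |` s)%fset) =
    take nu.+1 r ++ t :: drop nu.+1 r.
  apply: lt_sorted_eq; first exact: sorted_knots.
  - have := sorted_knots s; rewrite -/r -{1}(cat_take_drop nu.+1 r).
    rewrite !lt_sorted_pairwise !pairwise_cat => /and3P[rr r1 r2].
    rewrite r1 pairwise_cons r2 !andbT; apply/andP; split.
      apply/allrelP => x y xr; rewrite inE => /orP[/eqP->|]; first exact: lt1.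
      exact: (allrelP rr).
    by apply/allP => x; exact: lt2.
  - move=> x; rewrite mem_sort mem_cat in_cons orbCA -mem_cat cat_take_drop.
    by rewrite mem_sort in_fset1U.
rewrite /knot E nth_cat size_takel; last by rewrite sr; lia.
case: (ltngtP j nu.+1) => jnu.
- by rewrite -ltnS jnu nth_take.
- rewrite -[(j <= nu)%N]ltnS ltnNge (ltnW jnu)/=.
  case: j jnu => // j jnu; rewrite subSn; last by lia.
  by rewrite /= nth_drop subnKC//; lia.
- by rewrite jnu ltnn subnn.
Qed.

Lemma nknots_insert s t : subdivision1 s -> t \notin s ->
  nknots (t |` s)%fset = (nknots s).+1.
Proof. by move=> /subdivision1_card[m1 ms] ts; rewrite /nknots cardfsU1 ts; lia. Qed.

Lemma subdivision1_insert s t nu : subdivision1 s -> t \notin s ->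
  (0 < nu < nknots s)%N -> knot s nu < t < knot s nu.+1 ->
  subdivision1 (t |` s)%fset.
Proof.
move=> ds ts /andP[nu0 num] tnu; have [m1 ms] := subdivision1_card ds.
have K j := @knot_insert s t nu j ts _ tnu.
case: ds => k0 k1 km km1; rewrite /subdivision1 nknots_insert//.
split.
- by rewrite K//; lia.
- by rewrite K ?nu0//; lia.
- by rewrite K ?ifN//; lia.
- by rewrite K ?ifN//; lia.
Qed.

End Insert.

(** * Interpolants on a grid *)

Section Interpolation.
Context (R : realType) (d : nat).
Implicit Types (S : 'I_d -> {fset R}) (x : 'rV[R]_d).

Lemma midx_range S (l : midx S) i : (0 < midx_val l i <= nknots (S i))%N.
Proof. by rewrite /midx_val ltn_ord. Qed.

(** Distributing the product of the one-dimensional refinement formulas writes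
    each basis function of S in the basis of S', with its values at the grid
    points of S' as coefficients; the statement follows by linearity. *)
Lemma interp_refine S S' (a : coefs S) x : subdivision S -> subdivision S' ->
  (forall i, {subset S i <= S' i}) -> cube x ->
  interp a x = \sum_(l' : midx S') interp a (grid l') * Defs.basis l' x.
Proof.
move=> dS dS' SS' x01.
under [RHS]eq_bigr => l' _ do rewrite /interp mulr_suml.
rewrite exchange_big/=; apply: eq_bigr => l _.
under [RHS]eq_bigr => l' _ do rewrite -mulrA.
rewrite -mulr_sumr; congr (_ * _).
have E i : hat (knot (S i) (midx_val l i).-1) (knot (S i) (midx_val l i))
      (knot (S i) (midx_val l i).+1) (x ord0 i) =
    \sum_(j < nknots (S' i)) hatk (S i) (midx_val l i) (knot (S' i) j.+1) *
      hatk (S' i) j.+1 (x ord0 i).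
  by apply: hatk_refine; [exact: dS|exact: dS'|exact: SS'|exact: midx_range|exact: x01].
rewrite /Defs.basis; under eq_bigr => i _ do rewrite E.
rewrite (prod_sum_dffun (T := fun i => 'I_(nknots (S' i)))
  (fun i j => hatk (S i) (midx_val l i) (knot (S' i) j.+1) * hatk (S' i) j.+1 (x ord0 i))).
apply: eq_bigr => l' _; rewrite -big_split/=.
by apply: eq_bigr => i _; rewrite /grid !mxE.
Qed.

(** The basis functions are dual to the grid points. *)
Lemma interp_knots S (a : coefs S) (p : 'I_d -> nat) : subdivision S ->
  (forall i, (0 < p i <= nknots (S i))%N) ->
  interp a (\row_i knot (S i) (p i)) = coef_at a p.
Proof.
move=> dS pS; rewrite /coef_at; case: pickP => [l /forallP lp|nolp]; last first.
  have pS' i : ((p i).-1 < nknots (S i))%N by have := pS i; lia.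
  have /negP[] := nolp [ffun i => Ordinal (pS' i)].
  by apply/forallP => i; rewrite /midx_val ffunE/=; have := pS i; lia.
have basisE (l' : midx S) : Defs.basis l' (\row_i knot (S i) (p i)) =
    \prod_i (midx_val l' i == midx_val l i)%:R.
  apply: eq_bigr => i _; rewrite mxE -(eqP (lp i)).
  exact: (hatk_kron (dS i) (midx_range l' i) (midx_range l i)).
rewrite /interp (bigD1 l)//= basisE [X in _ * X]big1 ?mulr1; last first.
  by move=> i _; rewrite eqxx.
rewrite [X in _ + X]big1 ?addr0// => l' l'l.
have [i li] : exists i, l' i != l i.
  apply/existsP; apply: contraNT l'l; rewrite negb_exists => /forallP e.
  by apply/eqP/ffunP => i; apply/eqP; have := e i; rewrite negbK.
by rewrite basisE (bigD1 i)//= eqSS val_eqE (negbTE li) mul0r mulr0.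
Qed.

End Interpolation.

Definition first_at (R : realType) d (x : 'rV[R]_d.+1) (t : R) : 'rV[R]_d.+1 :=
  \row_i if i == ord0 then t else x ord0 i.

(** Only one factor of each basis function depends on the first coordinate, and
    this factor is affine between consecutive knots. *)
Lemma interp_cell_affine (R : realType) d (S : 'I_d.+1 -> {fset R}) (a : coefs S)
    (x : 'rV[R]_d.+1) k t :
  subdivision S -> (k.+1 < #|` S ord0|)%N ->
  let tl := knot (S ord0) k in let tr := knot (S ord0) k.+1 in
  tl <= t <= tr ->
  interp a (first_at x t) =
  interp a (first_at x tl) * ((tr - t) / (tr - tl)) +
  interp a (first_at x tr) * ((t - tl) / (tr - tl)).
Proof.
move=> dS kS tl tr tk; rewrite /interp !mulr_suml -big_split/=.
apply: eq_bigr => l _; rewrite -!mulrA -mulrDr; congr (_ * _).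
have E u : Defs.basis l (first_at x u) = hatk (S ord0) (midx_val l ord0) u *
    \prod_(i < d) hatk (S (lift ord0 i)) (midx_val l (lift ord0 i)) (x ord0 (lift ord0 i)).
  rewrite /Defs.basis big_ord_recl !mxE/=; congr (_ * _).
  by apply: eq_bigr => i _; rewrite !mxE.
rewrite !E (hatk_affine (dS ord0) _ kS (midx_range l ord0) tk)//.
by rewrite -/tl -/tr; ring.
Qed.

Section AddKnot.
Context (R : realType) (d : nat) (S : 'I_d.+1 -> {fset R}) (t : R) (nu : nat).
Hypotheses (dS : subdivision S) (tS : t \notin S ord0)
  (nuS : (0 < nu < nknots (S ord0))%N)
  (tnu : knot (S ord0) nu < t < knot (S ord0) nu.+1).
Let S' := add_knot S t.

Lemma subdivision_add_knot : subdivision S'.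
Proof.
move=> i; rewrite /S' /add_knot; case: ifP => [/eqP->|_]; last exact: dS.
exact: subdivision1_insert (dS ord0) tS nuS tnu.
Qed.

Lemma add_knot_sub i : {subset S i <= S' i}.
Proof.
move=> x xS; rewrite /S' /add_knot; case: ifP => // _.
by rewrite in_fset1U xS orbT.
Qed.

(** The three cases of [beta] are the values of the coarse interpolant at the
    fine grid: the knots before t keep their number, those after t are shifted by
    one, and at t itself the value is interpolated between the neighbours. *)
Lemma interp_beta (a : coefs S) (a' : coefs S') l :
  interp a (grid l) - a' l = beta nu a a' l.
Proof.
rewrite /beta; congr (_ - _).
set p := midx_val l.
have [m1 mS] := subdivision1_card (dS ord0).
have K j : knot (S' ord0) j = if (j <= nu)%N then knot (S ord0) j else
    if j == nu.+1 then t else knot (S ord0) j.-1.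
  by rewrite /S' /add_knot eqxx (@knot_insert _ _ _ nu)//; lia.
have p0 : (0 < p ord0 <= (nknots (S ord0)).+1)%N.
  have := midx_range l ord0.
  by rewrite /S' /add_knot eqxx nknots_insert.
have pS i : i != ord0 -> (0 < p i <= nknots (S i))%N.
  by move=> i0; have := midx_range l i; rewrite /S' /add_knot (negbTE i0).
have gridE : grid l = first_at (\row_i knot (S i) (p i)) (knot (S' ord0) (p ord0)).
  apply/rowP => i; rewrite !mxE -/p; case: ifP => [/eqP->//|i0].
  by rewrite /S' /add_knot i0.
have setE k : (0 < k <= nknots (S ord0))%N ->
    interp a (first_at (\row_i knot (S i) (p i)) (knot (S ord0) k)) =
    coef_at a (set_first k p).
  move=> kS; rewrite -interp_knots//; last first.
    by move=> i; rewrite /set_first; case: eqP => [->//|/eqP]; exact: pS.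
  congr interp; apply/rowP => i; rewrite !mxE /set_first.
  by case: eqP => [->|].
rewrite gridE K; case: ifP => [pnu|pnu].
  rewrite setE; last lia.
  congr coef_at; apply/funext => i; rewrite /set_first.
  by case: eqP => [->|].
case: ifP => [_|pnu1]; last by rewrite setE//; lia.
rewrite (@interp_cell_affine _ _ _ _ _ nu)//; last 2 first.
- lia.
- by case/andP: tnu => /ltW-> /ltW->.
by rewrite !setE//; lia.
Qed.

(** The coarse interpolant being a fine one, the difference is taken
    coefficientwise in the basis of S'. *)
Lemma interp_sub_add_knot (a : coefs S) (a' : coefs S') x : cube x ->
  interp a x - interp a' x = interp [ffun l => beta nu a a' l] x.
Proof.
move=> x01; rewrite (interp_refine a dS subdivision_add_knot add_knot_sub x01).
rewrite /interp -sumrB; apply: eq_bigr => l _.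
by rewrite ffunE -interp_beta -mulrBl.
Qed.

End AddKnot.

(** * One-dimensional integrals *)

Section CellIntegrals.
Context (R : realType).
Notation mu := (@lebesgue_measure R).

Lemma integral_horner (P : {poly R}) (a b : R) : a < b ->
  (\int[mu]_(x in `[a, b]) (P^`().[x])%:E = (P.[b] - P.[a])%:E)%E.
Proof.
move=> ab; rewrite EFinB; apply: continuous_FTC2 => //.
- by apply: continuous_subspaceT => x; exact: continuous_horner.
- split=> [x _||]; first exact: derivable_horner.
  + by apply: cvg_at_right_filter; exact: continuous_horner.
  + by apply: cvg_at_left_filter; exact: continuous_horner.
- by move=> x _; rewrite derivE.
Qed.

Lemma integral_quadratic (p q r a b : R) : a < b ->
  (\int[mu]_(x in `[a, b]) (p * x ^+ 2 + q * x + r)%:E =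
   (p * (b ^+ 3 - a ^+ 3) / 3 + q * (b ^+ 2 - a ^+ 2) / 2 + r * (b - a))%:E)%E.
Proof.
move=> ab.
pose P : {poly R} := (p / 3) *: 'X^3 + (q / 2) *: 'X^2 + r *: 'X.
have dP x : P^`().[x] = p * x ^+ 2 + q * x + r.
  rewrite /P !derivD !derivZ !derivXn derivX !(hornerE, hornerMn)/=.
  by field.
under eq_integral => x _ do rewrite -dP.
by rewrite integral_horner// /P !hornerE; congr EFin => /=; field.
Qed.

(** In the local coordinate on [u, v], the two affine functions with endpoint
    values a, b and a', b' have mass h/3 on equal endpoints and h/6 on opposite
    ones, with h = v - u. *)
Lemma integral_affine_product (u v a b a' b' : R) : u < v ->
  (\int[mu]_(x in `[u, v])
     ((((v - x) / (v - u)) * a + ((x - u) / (v - u)) * b) *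
      (((v - x) / (v - u)) * a' + ((x - u) / (v - u)) * b'))%:E =
   ((v - u) / 3 * (a * a' + b * b') + (v - u) / 6 * (a * b' + b * a'))%:E)%E.
Proof.
move=> uv; have h0 : v - u != 0 by rewrite subr_eq0 gt_eqF.
under eq_integral => x _.
  rewrite (_ : _ * _ =
    (b - a) * (b' - a') / (v - u) ^+ 2 * x ^+ 2 +
    ((b - a) * (v * a' - u * b') + (b' - a') * (v * a - u * b)) / (v - u) ^+ 2 * x +
    (v * a - u * b) * (v * a' - u * b') / (v - u) ^+ 2); last by field.
  over.
rewrite integral_quadratic//; congr EFin; field.
by rewrite h0.
Qed.

Lemma integral_cells (t : nat -> R) (a b : nat) (f : R -> R) :
  (a <= b)%N -> {in [pred k | (a <= k < b)%N], forall k, t k < t k.+1} ->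
  measurable_fun setT f -> (forall x, 0 <= f x) ->
  (\int[mu]_(x in `[t a, t b]) (f x)%:E =
   \sum_(a <= k < b) \int[mu]_(x in `[t k, t k.+1]) (f x)%:E)%E.
Proof.
move=> ab + mf f0; elim: b ab => [|b IH].
  rewrite leqn0 => /eqP-> _; rewrite big_geq// set_itv1.
  by rewrite integral_set1.
rewrite leq_eqVlt => /orP[/eqP-> _|].
  by rewrite big_geq// set_itv1 integral_set1.
rewrite ltnS => ab tlt.
have tk : {in [pred k | (a <= k < b)%N], forall k, t k < t k.+1}.
  by move=> k; rewrite inE => /andP[ak kb]; apply: tlt; rewrite inE ak ltnW.
rewrite big_nat_recr//= -IH//.
have tab : t a <= t b.
  have tan n : (a + n <= b)%N -> t a <= t (a + n)%N.
    elim: n => [|n IHn]; rewrite ?addn0// addnS => nb.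
    by rewrite (le_trans (IHn (ltnW nb)))// ltW// tk// inE nb leq_addr.
  by rewrite -(subnKC ab) tan// subnKC.
have tb : t b <= t b.+1 by rewrite ltW// tlt// inE ab ltnSn.
have mfE (D : set R) : measurable_fun D (fun x => (f x)%:E).
  by apply/measurable_EFinP; exact: measurable_funS mf.
rewrite (@itv_bndbnd_setU _ _ (BLeft (t a)) (BRight (t b)) (BRight (t b.+1)))//.
rewrite ge0_integral_setU//=; first last.
- by apply/disj_setPS => x [] /=; rewrite !in_itv/= => /andP[_ xb] /andP[]; rewrite ltNge xb.
- by move=> x _; rewrite lee_fin.
- exact: mfE.
by congr (_ + _)%E; rewrite integral_itv_obnd_cbnd.
Qed.

Lemma measurable_hat (u v w : R) : measurable_fun setT (hat u v w).
Proof.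
have ml (p q : R) : measurable_fun setT (fun t : R => p <= t <= q).
  by apply: measurable_and; apply: measurable_fun_ler.
rewrite /hat; apply: measurable_fun_ifT => //.
  by apply: measurable_funM => //; exact: measurable_funB.
apply: measurable_fun_ifT => //.
by apply: measurable_funM => //; exact: measurable_funB.
Qed.

(** Entry of the one-dimensional mass matrix; [Psi] is the tensor product of such matrices. *)
Definition mass (s : {fset R}) (l l' : nat) : R :=
  if (l <= l'.+1)%N && (l' <= l.+1)%N then psi s l l' else 0.

(** Cell number k contributes to the entry (l, l') only if l and l' both belong
    to {k, k+1}. So a diagonal entry collects h/3 from the one or two cells next
    to its knot, and an off-diagonal one collects h/6 from the cell in between. *)
Lemma integral_hatk (s : {fset R}) l l' : subdivision1 s ->
  (0 < l <= nknots s)%N -> (0 < l' <= nknots s)%N ->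
  (\int[mu]_(x in `[0%R, 1%R]) (hatk s l x * hatk s l' x)%:E = (mass s l l')%:E)%E.
Proof.
move=> ds lm lm'; have [m1 ms] := subdivision1_card ds.
have t_lt k : (k < (nknots s).+1)%N -> knot s k < knot s k.+1.
  by move=> km; apply: knot_lt; lia.
case: (ds) => k0 k1 km _; rewrite -{1}k1 -{1}km.
rewrite (integral_cells (a := 1) (b := nknots s)); last 4 first.
- exact: ltnW.
- by move=> k; rewrite inE => /andP[_ ?]; apply: t_lt; lia.
- by apply: measurable_funM; exact: measurable_hat.
- by move=> x; rewrite mulr_ge0// hatk_ge0.
pose h k := knot s k.+1 - knot s k.
have cellE k : (1 <= k < nknots s)%N ->
    (\int[mu]_(x in `[knot s k, knot s k.+1]) (hatk s l x * hatk s l' x)%:E =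
    (h k / 3 * ((l == k)%:R * (l' == k)%:R + (l == k.+1)%:R * (l' == k.+1)%:R) +
     h k / 6 * ((l == k)%:R * (l' == k.+1)%:R + (l == k.+1)%:R * (l' == k)%:R))%:E)%E.
  move=> /andP[k1' km']; rewrite -integral_affine_product; last by apply: t_lt; lia.
  apply: eq_integral => x; rewrite inE/= in_itv/= => kx.
  have E i : (0 < i <= nknots s)%N -> hatk s i x =
      (knot s k.+1 - x) / (knot s k.+1 - knot s k) * (i == k)%:R +
      (x - knot s k) / (knot s k.+1 - knot s k) * (i == k.+1)%:R.
    move=> im; rewrite (hatk_affine ds _ _ im kx)//; last lia.
    by rewrite !hatk_kron//; lia.
  by rewrite !E.
(* at most one cell has a given left end, and at most one a given right end;
   the extreme knots lack one of them *)
have pick1 (F : nat -> R) j : \sum_(1 <= k < nknots s) F k * (j == k)%:R =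
    if (1 <= j < nknots s)%N then F j else 0.
  rewrite -(big_nat1_eq +%R) big_mkcond/=; apply: eq_bigr => k _.
  by rewrite eq_sym; case: eqP => _; rewrite ?mulr1 ?mulr0.
have pick2 (F : nat -> R) j : (0 < j)%N -> \sum_(1 <= k < nknots s) F k * (j == k.+1)%:R =
    if (1 < j <= nknots s)%N then F j.-1 else 0.
  case: j => // j _; under eq_bigr => k _ do rewrite eqSS.
  by rewrite pick1.
(* the same contribution, sorted by the diagonal on which (l, l') lies *)
have cell_diagE k : (1 <= k < nknots s)%N ->
    (\int[mu]_(x in `[knot s k, knot s k.+1]) (hatk s l x * hatk s l' x)%:E =
    ((l == l')%:R * (h k / 3 * (l == k)%:R + h k / 3 * (l == k.+1)%:R) +
     ((l' == l.+1)%:R * (h k / 6 * (l == k)%:R) +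
      (l == l'.+1)%:R * (h k / 6 * (l' == k)%:R)))%:E)%E.
  move=> /cellE ->; congr EFin; rewrite -!natrM !mulnb.
  rewrite (_ : (l == k) && (l' == k) = (l == l') && (l == k)); last lia.
  rewrite (_ : (l == k.+1) && (l' == k.+1) = (l == l') && (l == k.+1)); last lia.
  rewrite (_ : (l == k) && (l' == k.+1) = (l' == l.+1) && (l == k)); last lia.
  rewrite (_ : (l == k.+1) && (l' == k) = (l == l'.+1) && (l' == k)); last lia.
  by rewrite -!mulnb !natrM; ring.
rewrite (eq_big_nat _ _ cell_diagE) sumEFin; congr EFin.
rewrite !big_split/= -!mulr_sumr big_split/= !pick1 pick2; last lia.
rewrite /mass /psi /h; have [ll'|ll'] := eqVneq l l'.
  rewrite -ll' leqnSn/= ltn_eqF// !mul0r !addr0 mul1r.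
  have [l1|l1] := eqVneq l 1%N; first by rewrite l1/= ifT ?addr0//; lia.
  have [lm1|lm1] := eqVneq l (nknots s).
    by rewrite ifF ?ifT ?add0r ?prednK//; lia.
  by rewrite !ifT ?prednK//; [field|lia..].
rewrite mul0r add0r; have [l'l|l'l] := eqVneq l' l.+1.
  rewrite l'l mul1r [X in X + _]ifT; last lia.
  have -> : (l == l.+2) = false by lia.
  rewrite mul0r addr0 ifT//; lia.
have [ll1|ll1] := eqVneq l l'.+1; last by rewrite !mul0r addr0 ifF//; lia.
rewrite mul0r add0r mul1r ifT; last lia.
by rewrite ifT ?ll1//; lia.
Qed.

End CellIntegrals.

(** * Integrals over the cube *)

Section TupleIntegral.
Context (R : realType).
Notation mu := (@lebesgue_measure R).

(** Tonelli's theorem, transported along (a, x) |-> a :: x. *)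
Lemma integral_lebesgue_cons n
    (m : {sigma_finite_measure set (n.-tuple (measurableTypeR R)) -> \bar R})
    (f : n.+1.-tuple (measurableTypeR R) -> R) :
  measurable_fun setT f -> (forall x, 0 <= f x) ->
  (\int[lebesgue_cons m]_x (f x)%:E =
   \int[mu]_a \int[m]_x (f [tuple of a :: x])%:E)%E.
Proof.
move=> mf f0.
have mcons : measurable_fun setT
    (fun p : measurableTypeR R * n.-tuple (measurableTypeR R) => [tuple of p.1 :: p.2]).
  exact: (measurable_cons measurable_fst measurable_snd).
transitivity (\int[(mu \x m)]_p (f [tuple of p.1 :: p.2])%:E)%E.
  rewrite [LHS](ge0_integral_pushforward mcons) ?preimage_setT//.
  - exact/measurable_EFinP.
  - by move=> x _; rewrite lee_fin.
rewrite (fubini_tonelli1 (fun p : measurableTypeR R * n.-tuple (measurableTypeR R) =>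
  (f [tuple of p.1 :: p.2])%:E))//.
- apply/measurable_EFinP; exact: measurableT_comp mf mcons.
- by move=> x; rewrite lee_fin.
Qed.

Lemma integral_lebesgue_tuple_prod n (g : 'I_n -> R -> R) (c : 'I_n -> R) :
  (forall i, measurable_fun setT (g i)) -> (forall i x, 0 <= g i x) ->
  (forall i, \int[mu]_x (g i x)%:E = (c i)%:E)%E ->
  (\int[lebesgue_tuple R n]_x (\prod_i g i (tnth x i))%:E = (\prod_i c i)%:E)%E.
Proof.
elim: n g c => [|n IH] g c mg g0 gc.
  rewrite /= integral_dirac//=; last first.
    by under eq_fun do rewrite big_ord0; exact: measurable_cst.
  by rewrite !big_ord0 diracT mul1e.
have mprod k (h : 'I_k -> R -> R) : (forall i, measurable_fun setT (h i)) ->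
    measurable_fun setT (fun x : k.-tuple (measurableTypeR R) => \prod_i h i (tnth x i)).
  move=> mh; apply: measurable_prod => i _.
  by apply: measurableT_comp (mh i) _; exact: measurable_tnth.
rewrite /= integral_lebesgue_cons; [|exact: mprod|]; last first.
  by move=> x; apply: prodr_ge0.
under eq_integral => a _.
  under eq_integral => x _.
    rewrite big_ord_recl; under eq_bigr => i _ do rewrite tnthS.
    rewrite (_ : tnth _ ord0 = a)// EFinM.
    over.
  rewrite ge0_integralZl_EFin//; last 2 first.
  - by move=> x _; rewrite lee_fin prodr_ge0.
  - by apply/measurable_EFinP; exact: (mprod _ (fun i => g (lift ord0 i))).
  rewrite (IH (fun i => g (lift ord0 i)) (fun i => c (lift ord0 i)))//.
  rewrite muleC.
  over.
rewrite ge0_integralZl_EFin//=.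
- by rewrite gc -EFinM mulrC big_ord_recl.
- by move=> x _; rewrite lee_fin.
- by apply/measurable_EFinP; exact: mg.
- apply: prodr_ge0 => i _; rewrite -lee_fin -gc; apply: integral_ge0 => x _.
  by rewrite lee_fin.
Qed.

Lemma measurable_tuple_cube d :
  measurable [set x : d.-tuple (measurableTypeR R) | cube (\row_i tnth x i)].
Proof.
rewrite (_ : [set _ | _] =
    \bigcap_(i in [set: 'I_d]) ((fun x => tnth x i) @^-1` `[0, 1]%classic)).
  apply: fin_bigcap_measurable => // i _.
  by rewrite -[X in measurable X]setTI; apply: measurable_tnth.
apply/seteqP; split => x /= H i; first by move=> _; have := H i; rewrite mxE/= in_itv.
by have := H i I; rewrite mxE/= in_itv.
Qed.

Lemma cube_integral_prod d (g : 'I_d -> R -> R) (c : 'I_d -> R) :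
  (forall i, measurable_fun setT (g i)) -> (forall i x, 0 <= g i x) ->
  (forall i, \int[mu]_(x in `[0%R, 1%R]) (g i x)%:E = (c i)%:E)%E ->
  cube_integral (fun x => \prod_i g i (x ord0 i)) = (\prod_i c i)%:E.
Proof.
move=> mg g0 gc; pose h i := g i \_ `[0, 1]%classic.
rewrite -(@integral_lebesgue_tuple_prod _ h); first last.
- by move=> i; rewrite -gc [RHS]integral_mkcond restrict_EFin.
- by move=> i x; rewrite /h patchE; case: ifP.
- move=> i; apply: (proj1 (measurable_restrictT (g i) _)) => //.
  exact: measurable_funS (mg i).
rewrite /cube_integral integral_mkcond; apply: eq_integral => x _.
(* outside the cube, the factor of some coordinate vanishes *)
rewrite patchE /h; case: ifPn => [|xcube].
  rewrite inE/= => xcube; congr EFin; apply: eq_bigr => i _.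
  rewrite patchE ifT ?mxE//.
  by apply/mem_set; rewrite /= in_itv/=; have := xcube i; rewrite mxE.
have [i xi] : exists i, ~~ (0 <= tnth x i <= 1).
  apply/existsP; apply: contraNT xcube; rewrite negb_exists => /forallP xc.
  by rewrite inE/= => i; rewrite mxE; have := xc i; rewrite negbK.
by rewrite (bigD1 i)//= patchE memNset ?mul0r//= in_itv/=; exact/negP.
Qed.

End TupleIntegral.

(** Expanding the square gives the entries of the mass matrix of the tensor
    product basis. These are products of one-dimensional entries, which vanish as
    soon as two indices differ by more than one in some direction. *)
Lemma integral_interp_sqr (R : realType) d (S : 'I_d -> {fset R}) (b : coefs S) :
  subdivision S ->
  cube_integral (fun x => interp b x ^+ 2) =
  (\sum_(l : midx S) \sum_(l' : midx S) b l * Psi l l' * b l')%:E.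
Proof.
move=> dS.
pose g (l l' : midx S) i x := hatk (S i) (midx_val l i) x * hatk (S i) (midx_val l' i) x.
pose G l l' (x : d.-tuple (measurableTypeR R)) :=
  \prod_i g l l' i ((\row_j tnth x j : 'rV[R]_d) ord0 i).
have hge (l : midx S) i x : 0 <= hatk (S i) (midx_val l i) x.
  exact: hatk_ge0 (dS i) (midx_range l i).
have intG l l' : cube_integral (fun x => \prod_i g l l' i (x ord0 i)) = (Psi l l')%:E.
  rewrite (@cube_integral_prod _ _ (g l l')
    (fun i => mass (S i) (midx_val l i) (midx_val l' i))).
  - rewrite /Psi; congr EFin; case: ifPn => [/forallP near|].
      by apply: eq_bigr => i _; rewrite /mass near.
    by rewrite negb_forall => /existsP[i far]; rewrite (bigD1 i)//= /mass (negbTE far) mul0r.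
  - by move=> i; apply: measurable_funM; exact: measurable_hat.
  - by move=> i x; rewrite mulr_ge0// hge.
  - by move=> i; apply: integral_hatk; [exact: dS|exact: midx_range..].
have mG l l' : measurable_fun setT (G l l').
  apply: measurable_prod => i _; rewrite /g.
  under eq_fun do rewrite mxE.
  have mh u : measurable_fun setT
      (fun x : d.-tuple (measurableTypeR R) => hatk (S i) u (tnth x i)).
    by apply: measurableT_comp; [exact: measurable_hat|exact: measurable_tnth].
  by apply: measurable_funM; exact: mh.
set D := [set x : d.-tuple (measurableTypeR R) | cube (\row_i tnth x i)].
have mD : measurable D := @measurable_tuple_cube R d.
have iG l l' : (lebesgue_tuple R d).-integrable D (EFin \o G l l').
  apply/integrableP; split; first by apply/measurable_EFinP; exact: measurable_funTS (mG l l').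
  have G0 x : 0 <= G l l' x by apply: prodr_ge0 => i _; exact: mulr_ge0.
  under eq_integral => x _ do rewrite /= ger0_norm//.
  by rewrite [ltLHS](intG l l') ltry.
have iGc (c : R) l l' : (lebesgue_tuple R d).-integrable D (fun x => c%:E * (G l l' x)%:E)%E.
  by apply: (integrableZl mD c (iG l l')).
rewrite /cube_integral -/D.
under eq_integral => x _.
  rewrite (_ : _ %:E =
    \sum_(l : midx S) \sum_(l' : midx S) (b l * b l')%:E * (G l l' x)%:E)%E; last first.
    rewrite expr2 /interp mulr_suml -sumEFin; apply: eq_bigr => l _.
    rewrite mulr_sumr -sumEFin; apply: eq_bigr => l' _.
    by rewrite -EFinM mulrACA /G big_split.
  over.
rewrite integral_sum//; last first.
  by move=> l; apply: integrable_sum => // l' _; exact: iGc.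
rewrite -sumEFin; apply: eq_bigr => l _.
rewrite integral_sum//.
rewrite -sumEFin; apply: eq_bigr => l' _.
rewrite integralZl//; last exact: iG.
by rewrite [X in (_ * X)%E](intG l l') -EFinM mulrAC.
Qed.

Theorem proposition3 (R : realType) (d D n : nat) (hdD : (d.+1 <= D)%N)
    (xD : 'I_n -> 'rV[R]_D) (y : 'I_n -> R)
    (xD_cube : forall i, cube (xD i))
    (xJ_inj : injective (fun i => first_coords hdD (xD i)))
    (CD : set ('rV[R]_D -> R))
    (CD_continuous : forall f, CD f -> {within @cube R D, continuous f})
    (CD_convex : convex_set (CD : set (convex_lmodType ('rV[R]_D -> R^o))))
    (CD_closed : closed (CD : set {uniform` @cube R D -> R}))
    (kD : 'rV[R]_D -> 'rV[R]_D -> R)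
    (kD_continuous : {within @cube R D `*` @cube R D,
       continuous (fun p : 'rV[R]_D * 'rV[R]_D => kD p.1 p.2)})
    (kD_covariance : covariance_on (@cube R D) kD)
    (gram_unit : forall T : 'I_d.+1 -> {fset R}, subdivision T ->
       gram (@restrict_kernel R d.+1 D kD) T \in unitmx)
    (S : 'I_d.+1 -> {fset R}) (S_subdivision : subdivision S)
    (t : R) (t01 : 0 <= t <= 1) (tS : t \notin S ord0)
    (nu : nat) (nu_range : (1 <= nu <= (nknots (S ord0)).-1)%N)
    (t_nu : knot (S ord0) nu < t < knot (S ord0) nu.+1)
    (feasible_S : feasible (restrict_class hdD CD)
       (fun i => first_coords hdD (xD i)) y (S:=S) !=set0)
    (feasible_S' : feasible (restrict_class hdD CD)
       (fun i => first_coords hdD (xD i)) y (S:=add_knot S t) !=set0) :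
  let S' := add_knot S t in
  let a := mode_coefs hdD CD kD xD y S in
  let a' := mode_coefs hdD CD kD xD y S' in
  cube_integral (fun x : 'rV[R]_d.+1 => (interp a x - interp a' x) ^+ 2) =
  (\sum_(l : midx S') \sum_(l' : midx S')
     beta nu a a' l * Psi l l' * beta nu a a' l')%:E.
Proof.
move=> S' a a'.
have [m1 _] := subdivision1_card (S_subdivision ord0).
have nuS : (0 < nu < nknots (S ord0))%N by lia.
transitivity (cube_integral (fun x => interp [ffun l => beta nu a a' l] x ^+ 2)).
  apply: eq_integral => x; rewrite inE/= => xcube.
  by rewrite (interp_sub_add_knot S_subdivision tS nuS t_nu).
rewrite integral_interp_sqr; last exact: subdivision_add_knot tS nuS t_nu.
by congr EFin; apply: eq_bigr => l _; apply: eq_bigr => l' _; rewrite !ffunE.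
Qed.
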